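(* There exists an integer $\delta_0$ such that every finite simple bipartite graph $G$ with $\delta(G)\ge\delta_0$ satisfies $\chi_2(G)-\chi(G)\le 2\left\lceil\frac{\Delta(G)}{\delta(G)}\right\rceil$.
   Context: $\delta$ and $\Delta$ denote minimum and maximum degree, $\chi$ the chromatic number. A dynamic coloring of $G$ is a proper vertex coloring such that for every vertex $v$ of degree at least $2$, the neighbours of $v$ receive at least two different colors; $\chi_2(G)$ is the smallest number of colors in a dynamic coloring of $G$. *)

(* Defs.v *)
From mathcomp Require Import all_boot all_order all_algebra.

Set Implicit Arguments.
Unset Strict Implicit.
Unset Printing Implicit Defensive.

Record sgraph := SGraph {
  vertex :> finType;
  adj : rel vertex;
  adj_sym : symmetric adj;
  adj_irrefl : irreflexive adj
}.

Section Graph.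
Variable G : sgraph.
Implicit Types (u v : G) (A : {set G}).

Definition neighbours v : {set G} := [set u | adj v u].

Definition degree v : nat := #|neighbours v|.

Definition max_degree : nat := \max_(v : G) degree v.

(* Starting the minimum from [max_degree] gives the minimum degree of every
   nonempty graph, and 0 for the graph without vertices. *)
Definition min_degree : nat := \big[minn/max_degree]_(v : G) degree v.

Definition independent A : bool :=
  [forall u in A, forall v in A, ~~ adj u v].

Definition bipartite : Prop :=
  exists A : {set G}, independent A && independent (~: A).

Definition proper_coloring k (c : {ffun G -> 'I_k}) : bool :=
  [forall u, forall v, adj u v ==> (c u != c v)].

Definition dynamic_coloring k (c : {ffun G -> 'I_k}) : bool :=
  proper_coloring c &&
  [forall v, (2 <= degree v) ==> (2 <= #|[set c u | u in neighbours v]|)].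

Definition colorable k : bool :=
  [exists c : {ffun G -> 'I_k}, proper_coloring c].

Definition dynamic_colorable k : bool :=
  [exists c : {ffun G -> 'I_k}, dynamic_coloring c].

Lemma dynamic_colorable_card : dynamic_colorable #|G|.
Proof.
apply/existsP; exists [ffun v => enum_rank v]; apply/andP; split.
  apply/forallP => u; apply/forallP => v; apply/implyP => uv.
  rewrite !ffunE (inj_eq enum_rank_inj); apply: contraTneq uv => ->.
  by rewrite adj_irrefl.
apply/forallP => v; apply/implyP => deg_v.
rewrite card_imset // => u w; rewrite !ffunE.
exact: enum_rank_inj.
Qed.

Lemma ex_dynamic_colorable : exists k, dynamic_colorable k.
Proof. by exists #|G|; exact: dynamic_colorable_card. Qed.

Lemma ex_colorable : exists k, colorable k.
Proof.
have [k /existsP [c /andP [c_proper _]]] := ex_dynamic_colorable.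
by exists k; apply/existsP; exists c.
Qed.

Definition chromatic_number : nat := ex_minn ex_colorable.

Definition dynamic_chromatic_number : nat := ex_minn ex_dynamic_colorable.

End Graph.

(* Main.v *)
(* Let q be the ceiling of Delta / delta.  If the vertices can be coloured with
   q + 1 colours so that no neighbourhood is monochromatic, then pairing this
   colour with the side of the bipartition gives a dynamic colouring with
   2 (q + 1) colours, while chi >= 2.
   Such a colouring exists by a counting argument of Rosenfeld, replacing the
   local lemma: adding one vertex to S multiplies the number of colourings of S
   without monochromatic edge inside S by at least q + 1/2.  Indeed a colouring
   spoilt by an edge of size >= m + 2 through the new vertex is determined by
   its restriction to S minus m vertices of that edge, and by induction there
   are at least (q + 1/2)^m times fewer of those. *)
Require Import Defs.
From mathcomp Require Import all_boot all_order all_algebra.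
From mathcomp Require Import zify.

Set Implicit Arguments.
Unset Strict Implicit.
Unset Printing Implicit Defensive.

(** * Counting colourings of a hypergraph without monochromatic edges *)

Section HypergraphColoring.

Variables (T I : finType) (e : I -> {set T}) (D m k : nat).
Hypothesis edge_size : forall i, m.+2 <= #|e i|.
Hypothesis vertex_degree : forall x, #|[set i | x \in e i]| <= D.
(** Equivalently D (k + 1/2)^(-m) <= 1/2: on average, the edges at a new vertex spoil at most half
    an extension per colouring, out of [k.+1]. *)
Hypothesis degree_bound : 2 * D * 2 ^ m <= (2 * k + 1) ^ m.

Implicit Types (f g : {ffun T -> 'I_k.+1}) (A S : {set T}).

Definition monochromatic f A : bool :=
  [forall x in A, forall y in A, f x == f y].

Lemma monochromaticP f A :
  reflect {in A &, forall x y, f x = f y} (monochromatic f A).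
Proof.
apply: (iffP forall_inP) => [mono x y xA yA | mono x xA].
  exact/eqP/(forall_inP (mono x xA)).
by apply/forall_inP => y yA; apply/eqP/mono.
Qed.

(* A colouring of [S] is encoded as a total one that is [ord0] outside [S]. *)
Definition good_colorings S : {set {ffun T -> 'I_k.+1}} :=
  [set f : {ffun T -> 'I_k.+1} | [forall x, (x \notin S) ==> (f x == ord0)]
        && [forall i, (e i \subset S) ==> ~~ monochromatic f (e i)]].

Lemma good_coloringsP S f :
  reflect ((forall x, x \notin S -> f x = ord0) /\
           (forall i, e i \subset S -> ~~ monochromatic f (e i)))
          (f \in good_colorings S).
Proof.
rewrite inE; apply: (iffP andP) => -[outS inS]; split.
- by move=> x xS; apply/eqP/(implyP (forallP outS x)).
- by move=> i /(implyP (forallP inS i)).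
- by apply/forallP => x; apply/implyP => xS; apply/eqP/outS.
- by apply/forallP => i; apply/implyP/inS.
Qed.

Definition restrict S f : {ffun T -> 'I_k.+1} :=
  [ffun x => if x \in S then f x else ord0].

Definition extend (v : T) (fc : {ffun T -> 'I_k.+1} * 'I_k.+1) :
    {ffun T -> 'I_k.+1} :=
  [ffun x => if x == v then fc.2 else fc.1 x].

(** Edges through [v] are left unchecked, so that for [v] outside [S] every good colouring has
    exactly [k.+1] extensions. *)
Definition extensions (v : T) S : {set {ffun T -> 'I_k.+1}} :=
  extend v @: setX (good_colorings S) [set: 'I_k.+1].

Lemma card_extensions v S :
  v \notin S -> #|extensions v S| = k.+1 * #|good_colorings S|.
Proof.
move=> vS; rewrite card_in_imset ?cardsX ?cardsT ?card_ord 1?mulnC //.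
move=> [f c] [g d] /setXP[/= /good_coloringsP[f0 _] _].
move=> /setXP[/= /good_coloringsP[g0 _] _] /ffunP eq_fg.
have := eq_fg v; rewrite !ffunE eqxx /= => ->; congr pair.
apply/ffunP => x; have := eq_fg x; rewrite !ffunE /=.
by case: eqP => // -> _; rewrite f0 ?g0.
Qed.

Lemma extensionsP v S f : v \notin S -> f \in extensions v S ->
  (forall x, x \notin v |: S -> f x = ord0) /\
  (forall i, e i \subset S -> ~~ monochromatic f (e i)).
Proof.
move=> vS /imsetP[[g c] /setXP[/= /good_coloringsP[g0 gS] _] ->]; split.
  by move=> x; rewrite !inE negb_or ffunE /= => /andP[/negPf-> /g0].
move=> i ieS; apply: contra (gS i ieS) => /monochromaticP mono.
apply/monochromaticP => x y xe ye; have := mono x y xe ye.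
rewrite !ffunE /= !ifN //.
  by apply: contraNneq vS => <-; exact: (subsetP ieS).
by apply: contraNneq vS => <-; exact: (subsetP ieS).
Qed.

(* A vertex [w] of the edge other than [v] and outside [U] determines the
   colour of the whole edge, hence of [v] and of [U]. *)
Lemma card_monochromatic_extensions v S i :
    v \notin S -> v \in e i -> e i \subset v |: S ->
  exists U : {set T}, [/\ U \subset S, #|U| = m &
    #|[set f in extensions v S | monochromatic f (e i)]|
      <= #|good_colorings (S :\: U)|].
Proof.
move=> vS ve eS.
have : 0 < #|e i :\ v| by have := cardsD1 v (e i); have := edge_size i; lia.
move=> /card_gt0P[w]; rewrite !inE => /andP[wv we].
have : m <= #|e i :\ v :\ w|.
  have := cardsD1 v (e i); have := cardsD1 w (e i :\ v).
  by rewrite ve !inE wv we; have := edge_size i; lia.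
move=> /card_geqP[s [s_uniq s_size s_sub]].
have sP x : x \in s -> [/\ x != w, x != v & x \in e i].
  by move=> /s_sub; rewrite !inE => /and3P.
have e_in_S x : x \in e i -> x != v -> x \in S.
  by move=> /(subsetP eS); rewrite !inE => /predU1P[->|//]; rewrite eqxx.
pose U : {set T} := [set x in s].
have US : U \subset S.
  by apply/subsetP => x; rewrite inE => /sP[_ xv xe]; exact: e_in_S.
exists U; split=> //; first by rewrite cardsE (card_uniqP s_uniq).
have wSU : w \in S :\: U.
  rewrite !inE e_in_S // andbT.
  by apply/negP => /sP[]; rewrite eqxx.
rewrite -(card_in_imset (f := restrict (S :\: U))).
  apply/subset_leq_card/subsetP => _ /imsetP[f + ->].
  rewrite inE => /andP[/(extensionsP vS)[_ fS] _].
  apply/good_coloringsP; split=> [x /negPf xSU|j ej]; first by rewrite ffunE xSU.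
  have ejS : e j \subset S by apply: subset_trans ej (subsetDl _ _).
  apply: contra (fS j ejS) => /monochromaticP mono.
  apply/monochromaticP => x y xe ye; have := mono x y xe ye.
  by rewrite !ffunE !(subsetP ej).
move=> f g; rewrite inE => /andP[/(extensionsP vS)[f0 _]].
move=> /monochromaticP fe; rewrite inE.
move=> /andP[/(extensionsP vS)[g0 _] /monochromaticP ge] /ffunP eq_fg.
have eq_w : f w = g w by have := eq_fg w; rewrite !ffunE wSU.
apply/ffunP => x; have [xe|xe] := boolP (x \in e i).
  by rewrite (fe x w) // (ge x w).
have [xS|xS] := boolP (x \in S); last first.
  have xvS : x \notin v |: S.
    by rewrite !inE negb_or xS andbT; apply: contraNneq xe => ->.
  by rewrite f0 // g0.
have xSU : x \in S :\: U.
  by rewrite inE xS andbT inE; apply: contra xe => /sP[].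
by have := eq_fg x; rewrite !ffunE xSU.
Qed.

(** An edge of [v |: S] that misses [v] lies in [S], where the extension is still good; only edges
    through [v] can spoil it. *)
Lemma extensions_cover v S : v \notin S ->
  extensions v S \subset good_colorings (v |: S) :|:
    \bigcup_(i | (v \in e i) && (e i \subset v |: S))
      [set f in extensions v S | monochromatic f (e i)].
Proof.
move=> vS; apply/subsetP => f fX; have [f0 fS] := extensionsP vS fX.
rewrite inE; case: (boolP (f \in _)) => //= fbad.
have [i /andP[ieS imono]|noi] :=
    pickP [pred i | (e i \subset v |: S) && monochromatic f (e i)].
  apply/bigcupP; exists i; last by rewrite inE fX.
  rewrite ieS andbT; apply: contraLR imono => vi; apply: fS.
  apply/subsetP => x xe; have := subsetP ieS x xe.
  by rewrite !inE => /predU1P[eq_xv|//]; rewrite -eq_xv xe in vi.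
case/negP: fbad; apply/good_coloringsP; split=> // i ieS.
by have := noi i; rewrite /= ieS => /= ->.
Qed.

Lemma leq_card_bigcup (J R : finType) (P : pred J) (F : J -> {set R}) :
  #|\bigcup_(j | P j) F j| <= \sum_(j | P j) #|F j|.
Proof.
elim/big_rec2: _ => [|j n A _ leAn]; first by rewrite cards0.
by rewrite (leq_trans (leq_card_setU _ _).1) // leq_add2l.
Qed.

(** Strong induction on the size of [S]; both sides are doubled to keep the factor k + 1/2 within
    the natural numbers. *)
Lemma good_colorings_growth v S : v \notin S ->
  (2 * k + 1) * #|good_colorings S| <= 2 * #|good_colorings (v |: S)|.
Proof.
have [n] := ubnP #|S|; elim: n v S => // n IHn v S ltSn vS.
(* The vertices of [U] are put back one at a time. Each gains a factor k + 1/2 by the outer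
   induction hypothesis, since [S :\: U] is smaller than [S] for nonempty [U]. *)
have shrink (U : {set T}) : U \subset S ->
    (2 * k + 1) ^ #|U| * #|good_colorings (S :\: U)|
      <= 2 ^ #|U| * #|good_colorings S|.
  have [p] := ubnP #|U|; elim: p U => // p IHp U ltUp US.
  have [->|/set0Pn[u uU]] := eqVneq U set0.
    by rewrite cards0 setD0.
  have cardU := cardsD1 u U; rewrite uU add1n in cardU.
  have uS : u \in S by apply: (subsetP US).
  have uSU : u \notin S :\: U by rewrite inE uU.
  have := IHp (U :\ u); rewrite (subset_trans (subsetDl _ _) US).
  have -> : S :\: (U :\ u) = u |: S :\: U.
    by apply/setP => x; rewrite !inE; case: eqP => // ->; rewrite uS.
  have ltS : #|S :\: U| < n.
    have : S :\: U \proper S.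
      by rewrite properE subsetDl; apply/subsetPn; exists u.
    by move=> /proper_card; lia.
  have := IHn u _ ltS uSU; rewrite cardU !expnS.
  set a := #|_|; set b := #|_|; move=> le_ab /(_ ltac:(lia) isT).
  set c := #|_|; set x := _ ^ _; set y := 2 ^ _; nia.
have := subset_leq_card (extensions_cover vS).
rewrite card_extensions // => /leq_trans/(_ (leq_card_setU _ _).1).
set bad := \bigcup_(i | _) _; move=> le_ext.
(* Losing 1/2 from the factor k + 1 leaves k + 1/2. *)
suff le_bad : 2 * #|bad| <= #|good_colorings S| by lia.
have pos : 0 < (2 * k + 1) ^ m by rewrite expn_gt0 addn1.
rewrite -(leq_pmul2l pos).
have -> : (2 * k + 1) ^ m * (2 * #|bad|) = 2 * ((2 * k + 1) ^ m * #|bad|) by lia.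
(* Union bound: at most [D] edges pass through [v], and [shrink] with [#|U| = m] bounds the share of
   each. *)
apply: (@leq_trans (2 * (D * (2 ^ m * #|good_colorings S|)))); last first.
  by rewrite !mulnA leq_mul2r degree_bound orbT.
rewrite leq_mul2l /=.
apply: (@leq_trans ((2 * k + 1) ^ m * \sum_(i | (v \in e i) && (e i \subset v |: S))
      #|[set f in extensions v S | monochromatic f (e i)]|)).
  by rewrite leq_mul2l leq_card_bigcup orbT.
rewrite big_distrr /=.
apply: (@leq_trans (\sum_(i in [set i | v \in e i]) 2 ^ m * #|good_colorings S|)).
  rewrite big_mkcond [X in _ <= X]big_mkcond /=; apply: leq_sum => i _.
  rewrite inE; case: (boolP (v \in e i)) => //= vi; case: ifP => // ieS.
  have [U [US Um le_mono]] := card_monochromatic_extensions vS vi ieS.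
  apply: leq_trans (_ : (2 * k + 1) ^ m * #|good_colorings (S :\: U)| <= _).
    by rewrite leq_mul2l le_mono orbT.
  by rewrite -Um; exact: shrink.
by rewrite sum_nat_const leq_mul2r vertex_degree orbT.
Qed.

(** The empty set has one good colouring, as no edge is empty, and the growth factor is positive
    even for [k = 0]. *)
Lemma good_colorings_gt0 S : 0 < #|good_colorings S|.
Proof.
have [n] := ubnP #|S|; elim: n S => // n IHn S ltSn.
have [->|/set0Pn[v vS]] := eqVneq S set0.
  apply/card_gt0P; exists [ffun=> ord0]; apply/good_coloringsP.
  split=> [x _|i]; first by rewrite ffunE.
  by rewrite subset0 => /eqP ei; have := edge_size i; rewrite ei cards0.
have := @good_colorings_growth v (S :\ v); rewrite setD1K // !inE eqxx.
have := IHn (S :\ v); have := cardsD1 v S; rewrite vS.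
by move=> cardS /(_ ltac:(lia)) ? /(_ isT); lia.
Qed.

Lemma ex_nonmonochromatic_coloring :
  exists f : {ffun T -> 'I_k.+1}, forall i, ~~ monochromatic f (e i).
Proof.
have /card_gt0P[f /good_coloringsP[_ fT]] := good_colorings_gt0 [set: T].
by exists f => i; apply: fT; rewrite subsetT.
Qed.

End HypergraphColoring.

(** * Degrees and colourings of bipartite graphs *)

Lemma leq_degree_max (G : sgraph) (v : G) : degree v <= max_degree G.
Proof. exact: (leq_bigmax v). Qed.

Lemma geq_degree_min (G : sgraph) (v : G) : min_degree G <= degree v.
Proof.
rewrite /min_degree; elim: index_enum (mem_index_enum v) => // u s IHs.
by rewrite inE big_cons geq_min => /predU1P[->|/IHs->]; rewrite ?leqnn ?orbT.
Qed.

Lemma dynamic_colorable_bipartite (G : sgraph) (A : {set G}) k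
    (f : {ffun G -> 'I_k.+1}) :
    independent A -> independent (~: A) ->
    (forall v, ~~ monochromatic f (neighbours v)) ->
  dynamic_colorable G (k.+1 + k.+1).
Proof.
move=> indA indAC nonmono.
(* Two disjoint palettes, one per side, make [c] proper; [f] can still be read off from [c]. *)
pose c := [ffun v => if v \in A then lshift k.+1 (f v) else rshift k.+1 (f v)].
have c_f x y : c x = c y -> f x = f y.
  by rewrite !ffunE; do 2!case: ifP => _ //;
     [move/lshift_inj | move/eqP | move/eqP | move/rshift_inj];
     rewrite ?eq_lrshift ?eq_rlshift.
apply/existsP; exists c; apply/andP; split.
  apply/forallP => u; apply/forallP => v; apply/implyP => uv.
  rewrite !ffunE; case: ifPn => uA; case: ifPn => vA.
  - by have := forall_inP (forall_inP indA u uA) v vA; rewrite uv.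
  - by rewrite eq_lrshift.
  - by rewrite eq_rlshift.
  - have := forall_inP (forall_inP indAC u _) v; rewrite !inE uv.
    by move=> /(_ uA vA).
apply/forallP => v; apply/implyP => _; rewrite ltnNge.
apply: contra (nonmono v) => /card_le1_eqP le1; apply/monochromaticP => x y xv yv.
by apply/c_f/le1; apply: imset_f.
Qed.

Lemma chromatic_number_gt1 (G : sgraph) (u v : G) :
  adj u v -> 1 < chromatic_number G.
Proof.
move=> uv; rewrite /chromatic_number; case: ex_minnP => k kcol _.
have /existsP[c /forallP/(_ u)/forallP/(_ v)] := kcol; rewrite uv /=.
by case: k c {kcol} => [|[|k]] // c; [case: (c u) | rewrite !ord1 eqxx].
Qed.

(** * Numerical estimates behind the threshold 12 *)

(** This is d 2^(d-2) <= 3^(d-3) for d = n + 12. It starts from 12288 <= 19683; each step triples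
    the right side and multiplies the left by at most 26/12. *)
Lemma leq_mul_exp2_exp3 n : (n + 12) * 2 ^ (n + 10) <= 3 ^ (n + 9).
Proof.
elim: n => [|n]; first by vm_compute.
by rewrite !addSn !expnS; set x := 2 ^ _; set y := 3 ^ _; nia.
Qed.

(** For q >= 1, 2 D 2^(d-2) <= (2q + 1) d 2^(d-2) <= (2q + 1) 3^(d-3) <= (2q + 1)^(d-2). For q = 0,
    D vanishes. *)
Lemma degree_bound_of_ratio d D q : 12 <= d -> D <= d * q ->
  2 * D * 2 ^ d.-2 <= (2 * q + 1) ^ d.-2.
Proof.
case: q => [|q] le12 leD; first by have -> : D = 0 by lia.
have [n dE] : exists n, d = n + 12 by exists (d - 12); lia.
rewrite {}dE in leD *.
have -> : (n + 12).-2 = n + 10 by lia.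
have le3 : 3 ^ (n + 9) <= (2 * q.+1 + 1) ^ (n + 9) by rewrite leq_exp2r; lia.
have := leq_mul_exp2_exp3 n.
have -> : (2 * q.+1 + 1) ^ (n + 10) = (2 * q.+1 + 1) * (2 * q.+1 + 1) ^ (n + 9).
  by rewrite -expnS -addnS.
move: le3; set x := 2 ^ _; set y := 3 ^ _; set z := _ ^ (n + 9) => le_yz le_xy.
apply: (@leq_trans ((2 * q.+1 + 1) * ((n + 12) * x))); last first.
  by rewrite leq_mul2l (leq_trans le_xy).
by rewrite mulnA leq_mul2r; apply/orP; right; nia.
Qed.

(** * The bound with the ceiling of the degree ratio *)

Import GRing.Theory Num.Theory.
Local Open Scope ring_scope.

Theorem theorem9 :
  exists delta0 : nat, forall G : sgraph,
    bipartite G ->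
    (delta0 <= min_degree G)%N ->
    (dynamic_chromatic_number G)%:Z - (chromatic_number G)%:Z
      <= 2 * Num.ceil ((max_degree G)%:R / (min_degree G)%:R : rat).
Proof.
exists 12%N => G [A /andP[indA indAC]] le12.
(* Without vertices the minimum degree defaults to 0, below the threshold. *)
have [v _|noG] := pickP [pred v : G | true]; last first.
  by move: le12; rewrite /min_degree /max_degree !big_pred0.
have le_min := @geq_degree_min G v.
have /card_gt0P[u] : (0 < #|neighbours v|)%N by rewrite -/(degree v); lia.
rewrite inE => /chromatic_number_gt1 chi2.
have d_gt0 : 0 < (min_degree G)%:R :> rat by rewrite ltr0n; lia.
have : (max_degree G)%:R <= (min_degree G)%:R
    * (Num.ceil ((max_degree G)%:R / (min_degree G)%:R : rat))%:~R :> rat.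
  by rewrite mulrC -ler_pdivrMr // ceil_ge.
have : 0 <= Num.ceil ((max_degree G)%:R / (min_degree G)%:R : rat).
  by rewrite -(ceil0 rat) ceil_le // divr_ge0 ?ler0n.
(* The ceiling is nonnegative, hence a natural number [q], and the ratio bound becomes Delta <=
   delta q. *)
case: (Num.ceil _) => // q _; rewrite -pmulrn -natrM ler_nat => le_Dq.
(* The 2 in 2(q + 1) is absorbed by chi >= 2. *)
suff : (dynamic_chromatic_number G <= q.+1 + q.+1)%N by lia.
have [f fN] : exists f : {ffun G -> 'I_q.+1},
    forall w, ~~ monochromatic f (neighbours w).
  (* The edges are the neighbourhoods, indexed by vertices. By symmetry of adjacency, [x] lies in as
     many of them as its degree. *)
  apply: (@ex_nonmonochromatic_coloring _ _ _ (max_degree G) (min_degree G).-2).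
  - by move=> w; have := @geq_degree_min G w; rewrite /degree; lia.
  - move=> x; apply: leq_trans (leq_degree_max _); apply: eq_leq.
    by apply: eq_card => w; rewrite !inE adj_sym.
  - exact: degree_bound_of_ratio.
rewrite /dynamic_chromatic_number; case: ex_minnP => n _; apply.
exact: dynamic_colorable_bipartite indA indAC fN.
Qed.
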